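(* Let $A_S$ be an irreducible Artin group of FC type with defining graph $\Gamma$. The complex of parabolic subgroups $\mathcal{CP}_{A_S}$ is connected if and only if $\Gamma$ is connected and has at least three vertices.
   Context: Let $\Gamma$ be a finite simplicial graph with vertex set $S=\{s_1,\dots,s_n\}$, where each edge between $s_i$ and $s_j$ is labeled by an integer $m_{ij}=m_{ji}\ge 2$. If there is no edge between $s_i$ and $s_j$ (with $i\neq j$), write $m_{ij}=\infty$. The Artin group $A_S$ associated to $\Gamma$ (its defining graph) is the group with generating set $S$ and, for every edge between $s_i$ and $s_j$, the relation $\underbrace{s_is_js_i\cdots}_{m_{ij}\text{ terms}}=\underbrace{s_js_is_j\cdots}_{m_{ij}\text{ terms}}$ (no relation when $m_{ij}=\infty$). The Coxeter group $W_S$ is the quotient of $A_S$ obtained by adding the relations $s_i^2=1$ for all $i$. $A_S$ is of finite type if $W_S$ is finite. For $T\subseteq S$, $A_T$ denotes the subgroup of $A_S$ generated by $T$; it is naturally isomorphic to the Artin group associated to the full labeled subgraph of $\Gamma$ spanned by $T$. A parabolic subgroup is a conjugate $gA_Tg^{-1}$ with $g\in A_S$, $T\subseteq S$; it is finite type if $A_T$ is of finite type (i.e. the Coxeter group $W_T$ of the full subgraph spanned by $T$ is finite), and proper if it is not equal to $A_S$. The Artin group $A_T$, and any parabolic subgroup $gA_Tg^{-1}$, is irreducible if $T\neq\emptyset$ and $T$ cannot be partitioned into two nonempty subsets $T_1\sqcup T_2$ such that every element of $T_1$ commutes with every element of $T_2$ (i.e. all $m_{ij}=2$ between $T_1$ and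 $T_2$). $A_S$ is of FC type if for every subset $T\subseteq S$ spanning a clique in $\Gamma$, $A_T$ is of finite type. Two parabolic subgroups $P,Q$ of $A_S$ are adjacent if either (i) $P\subsetneq Q$ or $Q\subsetneq P$; or (ii) $P\cap Q=\{1\}$ and $pq=qp$ for all $p\in P$, $q\in Q$. The complex of parabolic subgroups $\mathcal{CP}_{A_S}$ is the flag simplicial complex whose vertices are the proper irreducible finite type parabolic subgroups of $A_S$ (in particular nontrivial), with an edge between two distinct vertices exactly when they are adjacent. Convention: the empty complex (which occurs when $\Gamma$ is a single vertex) is not considered connected. *)

(* Defs.v *)
From Stdlib Require Import Relations.
From HB Require Import structures.
From mathcomp Require Import all_boot.
From mathcomp Require Import boolp classical_sets cardinality.

Set Implicit Arguments.
Unset Strict Implicit.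
Unset Printing Implicit Defensive.

Local Open Scope quotient_scope.
Local Open Scope classical_set_scope.

(* Groups given by a presentation < X | u = v, (u, v) in R >: words in the
   letters x^{+1} = (x, false) and x^{-1} = (x, true), modulo the congruence
   generated by free cancellation and by R. *)
Section Presentation.

Variable X : choiceType.

Definition word := seq (X * bool).

Definition inv_word (w : word) : word := rev [seq (a.1, ~~ a.2) | a <- w].

Variable R : word -> word -> Prop.

Inductive word_eq : word -> word -> Prop :=
| word_eq_refl u : word_eq u u
| word_eq_sym u v : word_eq u v -> word_eq v u
| word_eq_trans u v w : word_eq u v -> word_eq v w -> word_eq u w
| word_eq_cat u u' v v' :
    word_eq u u' -> word_eq v v' -> word_eq (u ++ v) (u' ++ v')
| word_eq_cancel x b : word_eq [:: (x, b); (x, ~~ b)] [::]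
| word_eq_relation u v : R u v -> word_eq u v.

Definition word_eqb (u v : word) : bool := `[< word_eq u v >].

Fact word_eqb_refl : reflexive word_eqb.
Proof. by move=> u; apply/asboolP; apply: word_eq_refl. Qed.

Fact word_eqb_sym : symmetric word_eqb.
Proof.
by move=> u v; apply/idP/idP => /asboolP h; apply/asboolP; apply: word_eq_sym.
Qed.

Fact word_eqb_trans : transitive word_eqb.
Proof.
move=> v u w /asboolP uv /asboolP vw; apply/asboolP.
exact: word_eq_trans uv vw.
Qed.

Canonical word_eq_equiv := EquivRel word_eqb
  word_eqb_refl word_eqb_sym word_eqb_trans.

Definition presented := {eq_quot word_eqb}.

HB.instance Definition _ := Choice.on presented.
HB.instance Definition _ := EqQuotient.on presented.

Lemma presented_eqP (u v : word) :
  \pi_presented u = \pi_presented v <-> word_eq u v.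
Proof.
split=> [/eqmodP/asboolP //|h]; apply/eqmodP; exact/asboolP.
Qed.

Lemma word_eq_repr (u : word) : word_eq (repr (\pi_presented u)) u.
Proof. by apply/presented_eqP; rewrite reprK. Qed.

Definition presented_one : presented := \pi_presented [::].
Definition presented_mul (g h : presented) : presented :=
  \pi_presented (repr g ++ repr h).
Definition presented_inv (g : presented) : presented :=
  \pi_presented (inv_word (repr g)).

Lemma presented_mulE (u v : word) :
  presented_mul (\pi_presented u) (\pi_presented v) = \pi_presented (u ++ v).
Proof. by apply/presented_eqP; apply: word_eq_cat; apply: word_eq_repr. Qed.

Fact word_eq_mulV (u : word) : word_eq (u ++ inv_word u) [::].
Proof.
elim: u => [|[x b] u IHu]; first exact: word_eq_refl.
have -> : ((x, b) :: u) ++ inv_word ((x, b) :: u)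
    = [:: (x, b)] ++ ((u ++ inv_word u) ++ [:: (x, ~~ b)]).
  by rewrite /inv_word /= rev_cons -cats1 catA.
apply: word_eq_trans (word_eq_cancel x b).
apply: (@word_eq_cat [:: (x, b)] [:: (x, b)] _ [:: (x, ~~ b)]).
  exact: word_eq_refl.
rewrite -[X in word_eq _ X]cat0s.
by apply: word_eq_cat => //; apply: word_eq_refl.
Qed.

Lemma inv_wordK : involutive inv_word.
Proof.
move=> u; rewrite /inv_word map_rev revK -map_comp map_id_in //.
by case=> x b _ /=; rewrite negbK.
Qed.

Fact presented_mulA : associative presented_mul.
Proof.
move=> g h k; rewrite -[g]reprK -[h]reprK -[k]reprK.
rewrite (presented_mulE (repr h) (repr k)) (presented_mulE (repr g) (repr h)).
by rewrite (presented_mulE (repr g)) (presented_mulE (_ ++ _)) catA.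
Qed.

Fact presented_mul1 : left_id presented_one presented_mul.
Proof. by move=> g; rewrite -[g]reprK (presented_mulE [::]). Qed.

Fact presented_1mul : right_id presented_one presented_mul.
Proof. by move=> g; rewrite -[g]reprK (presented_mulE _ [::]) cats0. Qed.

Fact presented_mulV : right_inverse presented_one presented_inv presented_mul.
Proof.
move=> g; rewrite -{1}[g]reprK (presented_mulE (repr g)).
by apply/presented_eqP; apply: word_eq_mulV.
Qed.

Fact presented_Vmul : left_inverse presented_one presented_inv presented_mul.
Proof.
move=> g; rewrite -{2}[g]reprK (presented_mulE _ (repr g)) -{2}[repr g]inv_wordK.
by apply/presented_eqP; apply: word_eq_mulV.
Qed.

HB.instance Definition _ := isGroup.Build presented
  presented_mulA presented_mul1 presented_1mul presented_Vmul presented_mulV.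

Definition presented_gen (x : X) : presented :=
  \pi_presented [:: (x, false)].

End Presentation.

Section Subgroups.

Variable A : groupType.

Definition is_subgroup (H : set A) : Prop :=
  [/\ H 1%g, forall x y, H x -> H y -> H (x * y)%g & forall x, H x -> H x^-1%g].

Definition generated (B : set A) : set A := smallest is_subgroup B.

Definition conjugate (g : A) (H : set A) : set A :=
  [set (g * h * g^-1)%g | h in H].

End Subgroups.

(* The values of [label] on non-edges are irrelevant; a non-edge between
   distinct vertices stands for m = infinity. *)
Record labeled_graph (S : finType) := LabeledGraph {
  edge : rel S;
  label : S -> S -> nat;
  edge_irr : irreflexive edge;
  edge_sym : symmetric edge;
  label_sym : forall s t, edge s t -> label s t = label t s;
  label_ge2 : forall s t, edge s t -> 2 <= label s t }.

Section Induced.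

Variables (S : finType) (G : labeled_graph S) (T : {set S}).

Let V : finType := {s : S | s \in T}.
Let edgeT (s t : V) := edge G (val s) (val t).
Let labelT (s t : V) := label G (val s) (val t).

Fact induced_irr : irreflexive edgeT.
Proof. by move=> s; apply: edge_irr. Qed.

Fact induced_sym : symmetric edgeT.
Proof. by move=> s t; apply: edge_sym. Qed.

Definition induced : labeled_graph V :=
  @LabeledGraph V edgeT labelT induced_irr induced_sym
    (fun s t => @label_sym S G (val s) (val t))
    (fun s t => @label_ge2 S G (val s) (val t)).

End Induced.

(* The positive word s t s t ... with n letters. *)
Definition alt_word (S : finType) (s t : S) (n : nat) : word S :=
  mkseq (fun i => (if odd i then t else s, false)) n.

Definition artin_relation (S : finType) (G : labeled_graph S) (u v : word S) :=
  exists s t, [/\ edge G s t, u = alt_word s t (label G s t)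
                & v = alt_word t s (label G s t)].

Definition artin_group (S : finType) (G : labeled_graph S) : groupType :=
  presented (artin_relation G).

Definition coxeter_relation (S : finType) (G : labeled_graph S) (u v : word S) :=
  artin_relation G u v \/
  exists s, u = [:: (s, false); (s, false)] /\ v = [::].

Definition coxeter_group (S : finType) (G : labeled_graph S) : groupType :=
  presented (coxeter_relation G).

Definition finite_type (S : finType) (G : labeled_graph S) : Prop :=
  finite_set [set: coxeter_group G].

Section Parabolic.

Variables (S : finType) (G : labeled_graph S).

Definition artin_gen (s : S) : artin_group G :=
  presented_gen (artin_relation G) s.

Definition standard_parabolic (T : {set S}) : set (artin_group G) :=
  generated [set artin_gen s | s in [set` T]].

(* The subgroup A_T, respectively any of its conjugates, is called irreducible
   (respectively of finite type) when T is irreducible (respectively when the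
   Coxeter group of the subgraph spanned by T is finite). *)
Definition irreducible (T : {set S}) : Prop :=
  T <> finset.set0 /\
  ~ exists T1 T2 : {set S},
      [/\ T1 <> finset.set0, T2 <> finset.set0, T1 :|: T2 = T,
          T1 :&: T2 = finset.set0 &
          forall s t, s \in T1 -> t \in T2 -> edge G s t /\ label G s t = 2].

Definition clique (T : {set S}) : Prop :=
  forall s t, s \in T -> t \in T -> s <> t -> edge G s t.

Definition fc_type : Prop :=
  forall T : {set S}, clique T -> finite_type (induced G T).

Definition proper_irreducible_finite_parabolic (P : set (artin_group G)) : Prop :=
  P <> setT /\
  exists (g : artin_group G) (T : {set S}),
    [/\ P = conjugate g (standard_parabolic T), irreducible T
      & finite_type (induced G T)].

Definition adjacent (P Q : set (artin_group G)) : Prop :=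
  [\/ P `<` Q, Q `<` P |
      P `&` Q = [set 1%g] /\ forall p q, P p -> Q q -> (p * q = q * p)%g].

End Parabolic.

(* An abstract simplicial complex is given by the set of its simplices, which
   are nonempty finite sets of vertices. *)
Definition flag_complex (V : Type) (vertex : set V) (adj : V -> V -> Prop) :
    set (set V) :=
  [set sigma | [/\ finite_set sigma, sigma !=set0, sigma `<=` vertex &
     forall x y, sigma x -> sigma y -> x <> y -> adj x y]].

(* Edge-path connectedness; the empty complex is not connected. *)
Definition complex_connected (V : Type) (K : set (set V)) : Prop :=
  (exists x, K [set x]) /\
  forall x y, K [set x] -> K [set y] ->
    clos_refl_trans V (fun a b => K [set a; b]) x y.

Definition parabolic_complex (S : finType) (G : labeled_graph S) :
    set (set (set (artin_group G))) :=
  flag_complex (@proper_irreducible_finite_parabolic S G)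
    (@adjacent S G).

Arguments parabolic_complex {S} G _.

(* Main.v *)
(** Conjugating the vertex A_x by the generator x does nothing, so the complex
    is connected as soon as all the standard vertices A_s lie in one component.
    For an edge {s, t} of Γ, the vertices A_s and A_t are adjacent if the label
    is 2, and both are contained in A_{s,t} otherwise, which is of finite type by
    the FC hypothesis and proper as soon as there are three vertices.  That
    s \notin T implies A_s :&: A_T = 1 follows from the action of A_S on functions
    on S deforming the reflection representation at q = 4.

    Conversely, actions of A_S by affine maps on a commutative ring, in which no
    conjugate of one generator commutes with a conjugate of another, separate
    the components: for a disconnected Γ or a single edge with an even label, a
    homothety and a translation; for a single edge with an odd label m, the two
    reflections of the integers modulo m generating the dihedral group. *)
From Stdlib Require Import Relations.
Require Import Defs.
From mathcomp Require Import boolp classical_sets cardinality.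
From mathcomp Require Import all_boot all_order all_algebra all_field.
From mathcomp Require Import ring zify.

Set Implicit Arguments.
Unset Strict Implicit.
Unset Printing Implicit Defensive.

(** * Actions of presented groups *)

Section WordAction.

Variables (X : choiceType) (R : word X -> word X -> Prop) (V : Type).
Variable f : X -> bool -> V -> V.

Definition act_word (w : word X) (v : V) : V :=
  foldr (fun a => f a.1 a.2) v w.

Lemma act_word_cat u w v : act_word (u ++ w) v = act_word u (act_word w v).
Proof. exact: foldr_cat. Qed.

(** Evaluation goes through the chosen representative; [act_pi] shows that every word of the class
    acts alike once inverse letters cancel and the relations hold. *)
Definition act (g : presented R) : V -> V := act_word (repr g).

Hypothesis fK : forall x b v, f x b (f x (~~ b) v) = v.
Hypothesis fR : forall u w, R u w -> act_word u =1 act_word w.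

Lemma act_word_eq u w : word_eq R u w -> act_word u =1 act_word w.
Proof.
elim=> {u w} [//|u w _ IH v|u w x _ IH1 _ IH2 v|u u' w w' _ IH1 _ IH2 v|x b v|].
- by rewrite IH.
- by rewrite IH1.
- by rewrite !act_word_cat IH2 IH1.
- exact: fK.
- exact: fR.
Qed.

Lemma act_pi w v : act (\pi_(presented R) w)%qT v = act_word w v.
Proof. exact/act_word_eq/word_eq_repr. Qed.

Lemma act1 v : act 1%g v = v.
Proof. exact: (act_pi [::]). Qed.

Lemma actM g h v : act (g * h)%g v = act g (act h v).
Proof. by rewrite [LHS]act_pi act_word_cat. Qed.

Lemma actVK g v : act g^-1%g (act g v) = v.
Proof. by rewrite -actM mulVg act1. Qed.

Lemma actKV g v : act g (act g^-1%g v) = v.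
Proof. by rewrite -actM mulgV act1. Qed.

Lemma act_gen x v : act (presented_gen R x) v = f x false v.
Proof. exact: (act_pi [:: (x, false)]). Qed.

End WordAction.

(** * Standard parabolic subgroups *)

Section Conjugates.

Local Open Scope classical_set_scope.
Local Open Scope group_scope.

Variable A : groupType.
Implicit Types (g h x y : A) (H K : set A).

Lemma is_subgroup_generated (B : set A) : is_subgroup (generated B).
Proof.
split=> [H [[]//]|x y Bx By H BH|x Bx H BH].
- case: (BH) => -[_ HM _] _.
  by apply: HM; [exact: Bx|exact: By].
- case: (BH) => -[_ _ HV] _.
  by apply: HV; exact: Bx.
Qed.

Lemma generated_sub (B H : set A) :
  is_subgroup H -> B `<=` H -> generated B `<=` H.
Proof. by move=> sgH BH x; apply. Qed.

Lemma conjugateE g H x : conjugate g H x = H (g^-1 * x * g).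
Proof.
apply/propext; split=> [[h Hh <-]|Hx]; first by rewrite !mulgA mulVg mul1g mulgVK.
by exists (g^-1 * x * g); rewrite // !mulgA mulgV mul1g mulgK.
Qed.

Lemma conjugateM g h H : conjugate g (conjugate h H) = conjugate (g * h) H.
Proof. by apply/funext=> x; rewrite !conjugateE invgM !mulgA. Qed.

Lemma conjugate1 H : conjugate 1 H = H.
Proof. by apply/funext=> x; rewrite conjugateE invg1 mul1g mulg1. Qed.

Lemma conjugateK g H : conjugate g^-1 (conjugate g H) = H.
Proof. by rewrite conjugateM mulVg conjugate1. Qed.

Lemma conjugate_sub g H K : H `<=` K -> conjugate g H `<=` conjugate g K.
Proof. by move=> HK x; rewrite !conjugateE; apply: HK. Qed.

Lemma conjugate_eqT g H : conjugate g H = [set: _] <-> H = [set: _].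
Proof.
have cT k : conjugate k [set: A] = [set: A].
  by apply/funext=> x; rewrite conjugateE.
by split=> [gH|->//]; rewrite -(conjugateK g H) gH.
Qed.

Lemma conjugate_self x H : is_subgroup H -> H x -> conjugate x H = H.
Proof.
move=> [_ HM HV] Hx; apply/funext=> y; rewrite conjugateE.
apply/propext; split=> [Hy|Hy]; last by apply/HM/Hx; apply/HM/Hy/HV.
have -> : y = x * (x^-1 * y * x) * x^-1 by rewrite !mulgA mulgV mul1g mulgK.
by apply/HM/HV/Hx; apply/HM.
Qed.

End Conjugates.

Section StandardParabolics.

Local Open Scope classical_set_scope.
Local Open Scope group_scope.

Variables (S : finType) (G : labeled_graph S).
Implicit Types (s t : S) (T U : {set S}) (g h : artin_group G).

Lemma is_subgroup_parabolic T : is_subgroup (@standard_parabolic S G T).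
Proof. exact: is_subgroup_generated. Qed.

Lemma one_parabolic T : @standard_parabolic S G T 1.
Proof. by case: (is_subgroup_parabolic T). Qed.

Lemma gen_parabolic T s : s \in T -> @standard_parabolic S G T (artin_gen G s).
Proof. by move=> sT H [_ BH]; apply: BH; exists s. Qed.

Lemma parabolic_sub T (H : set (artin_group G)) : is_subgroup H ->
  (forall s, s \in T -> H (artin_gen G s)) -> @standard_parabolic S G T `<=` H.
Proof. by move=> sgH TH; apply: generated_sub => // _ [s /TH Hs <-]. Qed.

Lemma parabolic_mono T U : T \subset U ->
  @standard_parabolic S G T `<=` @standard_parabolic S G U.
Proof.
move=> /subsetP TU; apply: parabolic_sub; first exact: is_subgroup_parabolic.
by move=> s /TU; apply: gen_parabolic.
Qed.

Lemma parabolicT : @standard_parabolic S G [set: S]%SET = [set: _].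
Proof.
apply/seteqP; split=> // g _; rewrite -[g]reprK.
case: (is_subgroup_parabolic [set: S]%SET) => A1 AM AV.
elim: (repr g) => [|[s b] w IHw]; first exact: A1.
have sA := gen_parabolic (in_setT s).
rewrite -cat1s -(presented_mulE (artin_relation G)); apply: AM => //.
case: b => //; suff -> : \pi_(artin_group G)%qT [:: (s, true)] = (artin_gen G s)^-1.
  exact: AV.
apply: (mulgI (artin_gen G s)); rewrite mulgV.
apply: etrans (presented_mulE _ _ _) _.
by apply/presented_eqP; exact: (word_eq_cancel _ s false).
Qed.

(** The pair of natural exponents stands for the integer exponent m - n in the cyclic group A_s. *)
Lemma parabolic1P s g : @standard_parabolic S G [set s]%SET g ->
  exists m n, g = artin_gen G s ^+ m * artin_gen G s ^- n.
Proof.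
pose x := artin_gen G s; have xx m n : commute (x ^+ m) (x ^- n).
  exact/commuteV/commuteX2.
move: g; apply: parabolic_sub; last first.
  by move=> t /set1P->; exists 1%N, 0%N; rewrite expg1 expg0 invg1 mulg1.
split=> [|_ _ [m [n ->]] [m' [n' ->]]|_ [m [n ->]]].
- by exists 0%N, 0%N; rewrite expg0 mul1g invg1.
- exists (m + m')%N, (n' + n)%N; rewrite !expgnDr invgM.
  by rewrite -!mulgA; congr (_ * _); rewrite !mulgA xx.
- by exists n, m; rewrite invgM invgK.
Qed.

Lemma alt_wordS s t n : alt_word s t n.+1 = (s, false) :: alt_word t s n.
Proof.
rewrite /alt_word /mkseq /= (iotaDl 1 0) -map_comp.
by congr cons; apply: eq_map => i /=; rewrite if_neg.
Qed.

Lemma act_alt_wordS (V : Type) (f : S -> bool -> V -> V) s t n v :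
  act_word f (alt_word s t n.+1) v = f s false (act_word f (alt_word t s n) v).
Proof. by rewrite alt_wordS. Qed.

Lemma act_alt_word_sym (V : Type) (f : S -> bool -> V -> V) s t n :
  (forall v, f s false v = f t false v) ->
  act_word f (alt_word s t n) =1 act_word f (alt_word t s n).
Proof. by move=> fst v; elim: n => // n IHn; rewrite !act_alt_wordS IHn fst. Qed.

Lemma gen_commute s t : edge G s t -> label G s t = 2 ->
  commute (artin_gen G s) (artin_gen G t).
Proof.
move=> st l2; apply: etrans (presented_mulE _ _ _) _.
apply: etrans (esym (presented_mulE _ _ _)).
apply/presented_eqP/word_eq_relation.
by exists s, t; rewrite l2.
Qed.

Lemma parabolic1_commute s t g h : edge G s t -> label G s t = 2 ->
  @standard_parabolic S G [set s]%SET g -> @standard_parabolic S G [set t]%SET h ->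
  g * h = h * g.
Proof.
move=> st l2 /parabolic1P[m [n ->]] /parabolic1P[m' [n' ->]].
have xy := gen_commute st l2.
set x := artin_gen G s in xy *; set y := artin_gen G t in xy *.
apply: commuteM; apply: commute_sym; apply: commuteM; try apply: commuteV;
  try apply: commute_sym; try apply: commuteV; exact: commuteX2.
Qed.

End StandardParabolics.

(** * Actions of Artin groups *)

Section ArtinAction.

Local Open Scope classical_set_scope.
Local Open Scope group_scope.

Variables (S : finType) (G : labeled_graph S) (V : Type).
Variable f : S -> bool -> V -> V.
Hypothesis fK : forall s b v, f s b (f s (~~ b) v) = v.
Hypothesis f_braid : forall s t, edge G s t ->
  act_word f (alt_word s t (label G s t))
    =1 act_word f (alt_word t s (label G s t)).

Local Notation ρ := (@act S (artin_relation G) V f).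

Lemma braid_act u w : artin_relation G u w -> act_word f u =1 act_word f w.
Proof. by move=> [s [t [st -> ->]]]; exact: f_braid. Qed.

Let ρ1 := act1 fK braid_act.
Let ρM := actM fK braid_act.
Let ρVK := actVK fK braid_act.
Let ρKV := actKV fK braid_act.
Let ρ_gen := act_gen fK braid_act.

Lemma parabolic_act_fix (T : {set S}) v : (forall s, s \in T -> f s false v = v) ->
  forall g, @standard_parabolic S G T g -> ρ g v = v.
Proof.
move=> fv; apply: parabolic_sub; last by move=> s /fv; rewrite ρ_gen.
split=> [|g h gv hv|g gv]; first exact: ρ1.
- by rewrite ρM hv.
- by rewrite -{1}gv ρVK.
Qed.

(** All generators in T act as one map, so the image of A_T is cyclic, generated by the action of s,
    and centralises it. *)
Lemma parabolic_act_commute (T : {set S}) s :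
  (forall t v, t \in T -> f t false v = f s false v) ->
  forall g, @standard_parabolic S G T g -> forall v, ρ g (f s false v) = f s false (ρ g v).
Proof.
move=> ft; apply: parabolic_sub; last by move=> t tT v; rewrite !ρ_gen !ft.
split=> [v|g h gv hv v|g gv v]; first by rewrite !ρ1.
- by rewrite !ρM hv gv.
- by rewrite -{1}[v](ρKV g) -gv ρVK.
Qed.

(** If P lies in Q, then p belongs to Q, whose image is cyclic and generated by that of q; the other
    inclusion is symmetric. Adjacency thus forces p and q to commute in the image, which a
    well-chosen action contradicts. *)
Lemma conjugate_act_commute (T U : {set S}) s t g h :
    (forall t v, t \in T -> f t false v = f s false v) ->
    (forall s v, s \in U -> f s false v = f t false v) ->
    s \in T -> t \in U ->
    let P := conjugate g (@standard_parabolic S G T) in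
    let Q := conjugate h (@standard_parabolic S G U) in
    [\/ P `<=` Q, Q `<=` P | forall p q, P p -> Q q -> p * q = q * p] ->
  let p := g * artin_gen G s * g^-1 in let q := h * artin_gen G t * h^-1 in
  forall v, ρ p (ρ q v) = ρ q (ρ p v).
Proof.
move=> fs ft sT tU P Q adj p q v.
have comm (k x : artin_group G) r (W : {set S}) : (forall t v, t \in W -> f t false v = f r false v) ->
    conjugate k (@standard_parabolic S G W) x ->
    forall v, ρ x (ρ (k * artin_gen G r * k^-1) v) = ρ (k * artin_gen G r * k^-1) (ρ x v).
  move=> fr; rewrite conjugateE => Wx {}v; have /(_ (ρ k^-1 v)) := parabolic_act_commute fr Wx.
  by rewrite !ρM !ρ_gen => /(congr1 (ρ k)); rewrite !ρKV => ->.
have Pp : P p by exists (artin_gen G s) => //; exact: gen_parabolic.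
have Qq : Q q by exists (artin_gen G t) => //; exact: gen_parabolic.
case: adj => [PQ|QP|PQ].
- exact: (comm _ _ _ _ ft (PQ _ Pp)).
- by rewrite -(comm _ _ _ _ fs (QP _ Qq)).
- by rewrite -!ρM PQ.
Qed.

End ArtinAction.

(** * The Burau-type action *)

Section Burau.

Import Order.TTheory GRing.Theory Num.Theory.
Local Open Scope ring_scope.

Variables (S : finType) (F : fieldType) (q : F) (B : S -> S -> F).
Hypothesis q_neq0 : q != 0.
Hypothesis B_diag : forall s, B s s = 1 + q.

(** A pseudo-reflection: it fixes the hyperplane φ s = 0 and multiplies the vector [B s] by 1 - (1 +
    q) = - q. The factor q^-1 gives the inverse map. *)
Definition burau (s : S) (b : bool) (φ : S -> F) : S -> F :=
  fun u => φ u - (if b then q^-1 else 1) * B s u * φ s.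

Lemma burauK s b φ : burau s b (burau s (~~ b) φ) = φ.
Proof. by apply/funext=> u; case: b; rewrite /burau /= B_diag; field. Qed.

Lemma burau_fix s b φ : φ s = 0 -> burau s b φ = φ.
Proof. by move=> φs; apply/funext=> u; rewrite /burau φs mulr0 subr0. Qed.

Lemma burau_commute s t φ : B s t = 0 -> B t s = 0 ->
  burau s false (burau t false φ) = burau t false (burau s false φ).
Proof. by move=> st ts; apply/funext=> u; rewrite /burau st ts; ring. Qed.

(** Each letter subtracts a multiple of [B s] or [B t], so two scalars describe the effect of the
    whole word on all coordinates. *)
Lemma burau_alt_coord s t n φ : exists X Y, forall u,
  act_word burau (alt_word s t n) φ u = φ u - B s u * X - B t u * Y.
Proof.
elim: n s t => [|n IHn] s t; first by exists 0, 0 => u; rewrite !mulr0 !subr0.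
have [X [Y XY]] := IHn t s.
exists (Y + act_word burau (alt_word t s n) φ s), X => u.
rewrite alt_wordS /= /burau XY.
by set z := act_word _ _ _ _; ring.
Qed.

(* The values met along an alternating word satisfy the recurrence
   h_(n+1) = - B s t h_n - q h_(n-1), with characteristic roots - p r and
   - p / r; this is its solution with h_0 = x and h_(-1) = - y / q. *)
Definition burau_rec (p r x y : F) (n : nat) : F :=
  (- p) ^+ n * ((y / p - x * r) * r ^+ n + (x / r - y / p) * r ^- n)
  / (r^-1 - r).

(** A letter s multiplies the value at s by - q and subtracts B s t times the old value at s from
    the value at t. Hence a pair (h_n, - q h_(n-1)) of values at s and t becomes (- q h_n, h_(n+1)),
    and the next letter t meets h_(n+1). *)
Lemma burau_alt_odd s t (p r : F) k φ : q = p ^+ 2 -> p != 0 -> r != 0 -> r ^+ 2 != 1 ->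
    B s t = p * (r + r^-1) -> B t s = p * (r + r^-1) ->
  let h := burau_rec p r (φ s) (φ t) in
  let ψ := act_word burau (alt_word s t k.*2.+1) φ in
  ψ s = - q * h k.*2 /\ ψ t = h k.*2.+1.
Proof.
move=> q2 p0 r0 r21 st ts h.
have rr : 1 + - r * r != 0 by rewrite mulNr -expr2 subr_eq0 eq_sym.
elim: k => [|k [IHs IHt]].
  rewrite alt_wordS /= /burau st B_diag /h /burau_rec q2 !expr0 expr1.
  by split; field; rewrite ?oner_eq0 ?p0 ?r0 ?rr.
rewrite doubleS !(act_alt_wordS _ _ _ k.*2.+2) !(act_alt_wordS _ _ _ k.*2.+1).
set ψ := act_word _ _ _ in IHs IHt *.
rewrite /burau st ts !B_diag IHs IHt /h /burau_rec q2 !exprS.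
have : r ^+ k.*2 != 0 by rewrite expf_neq0.
move: (r ^+ k.*2) => R R0.
by split; field; rewrite ?oner_eq0 ?p0 ?r0 ?R0 ?rr.
Qed.

(** At r^m = 1 the closed form collapses: up to the factor (- p)^m the word swaps the values at s
    and t, a description symmetric in s and t. *)
Lemma burau_alt_root s t (p r : F) m φ : q = p ^+ 2 -> p != 0 -> r ^+ 2 != 1 ->
    B s t = p * (r + r^-1) -> B t s = p * (r + r^-1) -> odd m -> r ^+ m = 1 ->
  let ψ := act_word burau (alt_word s t m) φ in
  ψ s = (- p) ^+ m * φ t /\ ψ t = (- p) ^+ m * φ s.
Proof.
move=> q2 p0 r21 st ts m_odd rm; pose k := m./2.
have mk : m = k.*2.+1 by rewrite -[LHS]odd_double_half m_odd.
have r0 : r != 0 by apply: contra_eq_neq rm => ->; rewrite mk expr0n eq_sym oner_eq0.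
have rr : 1 + - r * r != 0 by rewrite mulNr -expr2 subr_eq0 eq_sym.
have [] := burau_alt_odd k φ q2 p0 r0 r21 st ts.
have rk : r ^+ k.*2 = r^-1.
  by apply: (mulfI r0); rewrite -exprS -mk rm mulfV.
have pm : (- p) ^+ m = - p * (- p) ^+ k.*2 by rewrite {1}mk exprS.
rewrite -mk => ss tt ψ; rewrite /ψ ss tt /burau_rec rm rk pm q2.
by split; field; rewrite ?oner_eq0 ?p0 ?r0 ?rr.
Qed.

(** Both words have the same effect on the coordinates s and t. The scalars of [burau_alt_coord]
    solve a linear system given by these two coordinates, with determinant (1 + q)^2 - b^2 nonzero,
    so they agree too, and with them all other coordinates. *)
Lemma burau_braid_odd s t (p r : F) m φ : q = p ^+ 2 -> p != 0 -> r ^+ 2 != 1 ->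
    B s t = p * (r + r^-1) -> B t s = p * (r + r^-1) -> odd m -> r ^+ m = 1 ->
    (1 + q) ^+ 2 != (p * (r + r^-1)) ^+ 2 ->
  act_word burau (alt_word s t m) φ = act_word burau (alt_word t s m) φ.
Proof.
move=> q2 p0 r21 st ts m_odd rm; set b := p * _ in st ts * => qb.
have [ss tt] := burau_alt_root φ q2 p0 r21 st ts m_odd rm.
have [tt' ss'] := burau_alt_root φ q2 p0 r21 ts st m_odd rm.
have [X [Y XY]] := burau_alt_coord s t m φ.
have [Y' [X' XY']] := burau_alt_coord t s m φ.
have := XY s; have := XY t; have := XY' s; have := XY' t.
rewrite ss tt ss' tt' !B_diag st ts => -> ->.
move=> /eqP; rewrite -subr_eq0 => /eqP et /eqP; rewrite -subr_eq0 => /eqP es.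
have Q : (1 + q) ^+ 2 - b ^+ 2 != 0 by rewrite subr_eq0.
have XX : X = X'.
  apply/(mulfI Q)/eqP; rewrite -subr_eq0; apply/eqP.
  by transitivity ((1 + q) * 0 - b * 0); [rewrite -{1}es -et|]; ring.
have YY : Y = Y'.
  apply/(mulfI Q)/eqP; rewrite -subr_eq0; apply/eqP.
  by transitivity ((1 + q) * 0 - b * 0); [rewrite -{1}et -es|]; ring.
by apply/funext=> u; rewrite XY XY' XX YY; ring.
Qed.

End Burau.

Section BurauArtin.

Import Order.TTheory GRing.Theory Num.Theory.
Local Open Scope ring_scope.

(** A primitive m-th root works, since m odd and m > 1 give m > 2. The condition on the square keeps
    the characteristic roots of the recurrence distinct. *)
Lemma odd_unity_root : exists r : nat -> algC,
  forall m, odd m -> (1 < m)%N -> r m ^+ m = 1 /\ r m ^+ 2 != 1.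
Proof.
have [|r rP] := @choice nat algC
    (fun m z => odd m -> (1 < m)%N -> z ^+ m = 1 /\ z ^+ 2 != 1); last by exists r.
case=> [|m]; first by exists 0.
have [z zP] := C_prim_root_exists (ltn0Sn m).
exists z => m_odd m1; split; first exact: prim_expr_order.
rewrite -(prim_order_dvd zP); apply/negP => /(dvdn_leq (ltn0Sn 1)) m2.
have : m.+1 = 2 by apply/eqP; rewrite eqn_leq m2.
by move=> mE; rewrite mE in m_odd.
Qed.

Variables (S : finType) (G : labeled_graph S).

Let r : nat -> algC := projT1 (cid odd_unity_root).

(** For an even label or a non-edge the entry 0 makes the two generators commute, so braid relations
    of even length hold trivially. For an odd label the entry is p (r + 1/r) with p = 2 a square
    root of q = 4. *)
Definition burau_matrix (s t : S) : algC :=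
  if s == t then 1 + 4
  else if edge G s t && odd (label G s t)
    then 2 * (r (label G s t) + (r (label G s t))^-1)
  else 0.

Local Notation burau4 := (burau 4 burau_matrix).

Lemma burau_matrix_diag s : burau_matrix s s = 1 + 4.
Proof. by rewrite /burau_matrix eqxx. Qed.

Lemma four_neq0 : 4 != 0 :> algC. Proof. by rewrite pnatr_eq0. Qed.

Lemma burau_braid s t : edge G s t ->
  act_word burau4 (alt_word s t (label G s t))
    =1 act_word burau4 (alt_word t s (label G s t)).
Proof.
move=> st φ; have ts : edge G t s by rewrite edge_sym.
have sNt : s != t by apply: contraTneq st => ->; rewrite edge_irr.
have m2 := label_ge2 st; have lts := label_sym st.
case: (boolP (odd (label G s t))) => m_odd; last first.
  have b0 : burau_matrix s t = 0.
    by rewrite /burau_matrix (negPf sNt) st (negPf m_odd).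
  have b0' : burau_matrix t s = 0.
    by rewrite /burau_matrix eq_sym (negPf sNt) ts -lts (negPf m_odd).
  rewrite -[label G s t]odd_double_half (negPf m_odd) add0n.
  elim: _./2 => // n IHn.
  rewrite doubleS !act_alt_wordS IHn.
  exact: burau_commute.
set m := label G s t in m2 lts m_odd *.
have [rm r2] : r m ^+ m = 1 /\ r m ^+ 2 != 1.
  exact: (projT2 (cid odd_unity_root)).
have bE : burau_matrix s t = 2 * (r m + (r m)^-1).
  by rewrite /burau_matrix (negPf sNt) st m_odd.
have bE' : burau_matrix t s = 2 * (r m + (r m)^-1).
  by rewrite /burau_matrix eq_sym (negPf sNt) ts -lts m_odd.
apply: (burau_braid_odd burau_matrix_diag φ _ _ r2 bE bE' m_odd rm).
- by rewrite -natrX.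
- by rewrite pnatr_eq0.
have r0 : r m != 0.
  by apply: contra_eq_neq rm => ->; rewrite expr0n eqn0Ngt (ltnW m2) eq_sym oner_eq0.
(* The determinant below factors as (4 - r^2)(4 - r^-2); a zero factor would make 4 an m-th root of
   unity. *)
have fourm : (4 : algC) ^+ m != 1.
  by rewrite -natrX pnatr_eq1 -(expn0 4) eqn_exp2l // eqn0Ngt (ltnW m2).
have E : (1 + 4) ^+ 2 - (2 * (r m + (r m)^-1)) ^+ 2
    = (4 - r m ^+ 2) * (4 - (r m)^-1 ^+ 2) :> algC by field.
rewrite -subr_eq0 E mulf_eq0 !subr_eq0 negb_or.
by apply/andP; split; apply: contra_neq fourm => ->;
  rewrite exprAC; [rewrite rm|rewrite (exprVn _ m) rm invr1]; rewrite expr1n.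
Qed.

Local Notation ρ := (@act S (artin_relation G) (S -> algC) burau4).

Let ρK := burauK four_neq0 burau_matrix_diag.

(** Every generator but s fixes [δ s], while s multiplies its coordinate at s by -4: this vector
    separates s from A_T. *)
Let δ (s : S) : S -> algC := fun u => (s == u)%:R.

Let parabolic_fix_δ (T : {set S}) s : s \notin T ->
  forall g, @standard_parabolic S G T g -> ρ g (δ s) = δ s.
Proof.
move=> sT; apply: (parabolic_act_fix ρK burau_braid) => t tT.
rewrite burau_fix // /δ; case: eqP => // st.
by rewrite st tT in sT.
Qed.

Let gen_δ s n : ρ (artin_gen G s ^+ n)%g (δ s) s = (-4) ^+ n.
Proof.
elim: n => [|n IHn]; first by rewrite (act1 ρK (braid_act burau_braid)) /δ eqxx.
rewrite expgS (actM ρK (braid_act burau_braid)) (act_gen ρK (braid_act burau_braid)).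
by rewrite /burau IHn burau_matrix_diag exprS; ring.
Qed.

Lemma parabolic_gen_mem (T : {set S}) s :
  @standard_parabolic S G T (artin_gen G s) -> s \in T.
Proof.
apply: contraPT => sT /(parabolic_fix_δ sT) /(congr1 (fun φ => φ s)).
have := gen_δ s 1; rewrite expg1 expr1 => ->; rewrite /δ eqxx => /eqP.
by rewrite lt_eqF // (@lt_trans _ _ 0) ?ltr01 // oppr_lt0 ltr0n.
Qed.

(** An element x^m x^-n of A_T fixes [δ s], whence (-4)^m = (-4)^n; absolute values give m = n. *)
Lemma parabolic1_trivI (T : {set S}) s g : s \notin T ->
  @standard_parabolic S G [set s]%SET g -> @standard_parabolic S G T g -> g = 1%g.
Proof.
move=> sT /parabolic1P[m [n ->]] /(parabolic_fix_δ sT) fixδ.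
have /(congr1 (fun φ => φ s)) : ρ (artin_gen G s ^+ m)%g (δ s)
    = ρ (artin_gen G s ^+ n)%g (δ s).
    rewrite -[in RHS]fixδ -(actM ρK (braid_act burau_braid)).
  congr (ρ _ (δ s)); rewrite mulgA.
  have -> : (artin_gen G s ^+ n * artin_gen G s ^+ m = artin_gen G s ^+ m * artin_gen G s ^+ n)%g.
    exact: commuteX2.
  by rewrite mulgK.
rewrite !gen_δ => /(congr1 Num.norm); rewrite !normrX normrN normr_nat -!natrX.
by move/eqP; rewrite eqr_nat eqn_exp2l // => /eqP->; rewrite mulgV.
Qed.


End BurauArtin.

(** * Edge paths in the complex of parabolic subgroups *)

Section FlagComplex.

Local Open Scope classical_set_scope.

Variables (V : Type) (vertex : set V) (adj : V -> V -> Prop).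

Lemma flag_vertex x : flag_complex vertex adj [set x] <-> vertex x.
Proof.
split=> [[_ _ + _]|vx]; first exact.
by split=> [||_ -> //|y z -> ->]; [exact: finite_set1|exists x|].
Qed.

(** The case x = y is allowed, as the pair is then a single vertex and the path step is constant;
    both orders occur because the flag condition ranges over ordered pairs. *)
Lemma flag_edgeP x y : flag_complex vertex adj [set x; y] <->
  [/\ vertex x, vertex y & x <> y -> adj x y /\ adj y x].
Proof.
split=> [[_ _ vxy axy]|[vx vy axy]].
  split=> [||xy].
  - by apply: vxy; left.
  - by apply: vxy; right.
  - by split; apply: axy; try (by left); try (by right); move=> // /esym.
split.
- by rewrite finite_setU; split; exact: finite_set1.
- by exists x; left.
- by move=> _ [->|->].
- move=> _ _ [->|->] [->|->] // xy; first exact: (axy xy).1.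
  by apply: (axy _).2 => /esym.
Qed.

(** The tool for disconnectedness: a property handed on by adjacency cannot distinguish two vertices
    of a connected complex. *)
Lemma connected_invariant (I : V -> Prop) :
    (forall x y, vertex x -> vertex y -> adj x y -> I x -> I y) ->
    complex_connected (flag_complex vertex adj) ->
  forall x y, vertex x -> vertex y -> I x -> I y.
Proof.
move=> adjI [_ conn] x y /flag_vertex vx /flag_vertex vy.
elim: {vx vy}(conn _ _ vx vy) => // {}x {}y => [/flag_edgeP[vx vy xy]|z _ xy _ yz].
  have [<-//|/xy[+ _]] := pselect (x = y).
  exact: adjI.
by move/xy.
Qed.

End FlagComplex.

(** * Paths between vertices when Γ is connected *)

Section ParabolicComplex.

Local Open Scope classical_set_scope.
Local Open Scope group_scope.

Variables (S : finType) (G : labeled_graph S).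
Implicit Types (P Q : set (artin_group G)) (T U : {set S}) (s t : S).

Local Notation par := (@standard_parabolic S G).
Local Notation vertex := (@proper_irreducible_finite_parabolic S G).

Definition parabolic_path : relation (set (artin_group G)) :=
  clos_refl_trans _ (fun P Q => parabolic_complex G [set P; Q]).

Lemma parabolic_neqT T s : s \notin T -> par T <> [set: _].
Proof. by move=> sT TT; move: sT; rewrite (@parabolic_gen_mem _ G T) // TT. Qed.

Lemma adjacent_sym P Q : adjacent P Q -> adjacent Q P.
Proof.
case=> [PQ|QP|[PQ pq]]; [exact: Or32|exact: Or31|apply: Or33].
by split=> [|q p Qq Pp]; [rewrite classical_sets.setIC|rewrite -pq].
Qed.

Lemma adjacent_nested_or_commute P Q : adjacent P Q ->
  [\/ P `<=` Q, Q `<=` P | forall p q, P p -> Q q -> p * q = q * p].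
Proof. by case=> [[PQ _]|[QP _]|[_ PQ]]; [exact: Or31|exact: Or32|exact: Or33]. Qed.

Lemma parabolic_edgeP P Q : parabolic_complex G [set P; Q] <->
  [/\ vertex P, vertex Q & P <> Q -> adjacent P Q].
Proof.
split=> [/flag_edgeP[vP vQ PQ]|[vP vQ PQ]].
  by split=> // /PQ[].
by apply/flag_edgeP; split=> // /PQ PQa; split=> //; exact: adjacent_sym.
Qed.

Lemma sub_edge P Q : vertex P -> vertex Q -> P `<=` Q -> parabolic_complex G [set P; Q].
Proof.
move=> vP vQ PQ; apply/parabolic_edgeP; split=> // PNQ; apply: Or31; split=> // QP.
by apply: PNQ; apply/seteqP.
Qed.

Lemma parabolic_path_sym P Q : parabolic_path P Q -> parabolic_path Q P.
Proof.
elim=> {P Q} [P Q PQ|P|P R Q _ RP _ QR].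
- by apply: rt_step; rewrite classical_sets.setUC.
- exact: rt_refl.
- exact: rt_trans QR RP.
Qed.

Lemma vertex_conjugate g P : vertex P -> vertex (conjugate g P).
Proof.
move=> [PT [h [T [PE irrT finT]]]]; split; first by move/conjugate_eqT.
by exists (g * h), T; rewrite -conjugateM -PE.
Qed.

Lemma adjacent_conjugate g P Q : adjacent P Q -> adjacent (conjugate g P) (conjugate g Q).
Proof.
have pc P' Q' : P' `<` Q' -> conjugate g P' `<` conjugate g Q'.
  move=> [PQ QP]; split; first exact: conjugate_sub.
  by move=> /(@conjugate_sub _ g^-1); rewrite !conjugateK.
case=> [PQ|QP|[PQ pq]]; [exact/Or31/pc|exact/Or32/pc|apply: Or33].
split=> [|_ _ [p Pp <-] [q Qq <-]]; last first.
  by rewrite !mulgA !mulgVK -!(mulgA g) (pq p q).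
apply/seteqP; split=> [x|_ ->].
  rewrite /setI /= !conjugateE => PQx.
  have : (P `&` Q) (g^-1 * x * g) by [].
  rewrite PQ => /= /(congr1 (fun y => g * y * g^-1)).
  by rewrite !mulgA mulgV mul1g mulgK mulg1 mulgV.
rewrite /setI /= !conjugateE mulg1 mulVg.
by have : (P `&` Q) 1 by rewrite PQ.
Qed.

Lemma parabolic_path_conjugate g P Q :
  parabolic_path P Q -> parabolic_path (conjugate g P) (conjugate g Q).
Proof.
elim=> {P Q} [P Q /parabolic_edgeP[vP vQ PQ]|P|P R Q _ RP _ QR].
- apply/rt_step/parabolic_edgeP; split; try exact: vertex_conjugate.
  by move=> gPQ; apply/adjacent_conjugate/PQ => PQE; rewrite PQE in gPQ.
- exact: rt_refl.
- exact: rt_trans RP QR.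
Qed.

Lemma irreducible1 s : irreducible G [set s]%SET.
Proof.
split=> [/setP/(_ s)|[T1 [T2 [/eqP/set0Pn[x xT1] /eqP/set0Pn[y yT2] T12 T120 _]]]].
  by rewrite !inE eqxx.
have xs : x = s by apply/set1P; rewrite -T12 inE xT1.
have ys : y = s by apply/set1P; rewrite -T12 inE yT2 orbT.
have : s \in T1 :&: T2 by rewrite inE -{1}xs xT1 -ys yT2.
by rewrite T120 inE.
Qed.

Lemma irreducible2 s t : s != t -> ~ (edge G s t /\ label G s t = 2) ->
  irreducible G [set s; t]%SET.
Proof.
move=> sNt st2; have ts2 : ~ (edge G t s /\ label G t s = 2).
  by move=> [ts lts]; apply: st2; rewrite edge_sym ts -(label_sym ts).
split=> [/setP/(_ s)|]; first by rewrite !inE eqxx.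
move=> [T1 [T2 [/eqP/set0Pn[x xT1] /eqP/set0Pn[y yT2] T12 T120 all2]]].
have xst : x \in [set s; t]%SET by rewrite -T12 inE xT1.
have yst : y \in [set s; t]%SET by rewrite -T12 inE yT2 orbT.
have xNy : x != y.
  apply/eqP => xy; have : x \in T1 :&: T2 by rewrite inE xT1 xy.
  by rewrite T120 inE.
have xy2 := all2 _ _ xT1 yT2; move: xy2 xNy.
by case/set2P: xst => ->; case/set2P: yst => -> //; rewrite ?eqxx.
Qed.

Hypothesis fcG : fc_type G.

(** A singleton is a clique, so A_s is of finite type; the other vertex t witnesses that A_s is
    proper. *)
Lemma vertex1 s t : s != t -> vertex (par [set s]%SET).
Proof.
move=> sNt; split.
  by apply: (@parabolic_neqT _ t); rewrite inE eq_sym.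
exists 1, [set s]%SET; rewrite conjugate1; split=> //; first exact: irreducible1.
by apply: fcG => _ _ /set1P-> /set1P->.
Qed.

Lemma vertex2 s t u : edge G s t -> label G s t != 2 -> u \notin [set s; t]%SET ->
  vertex (par [set s; t]%SET).
Proof.
move=> st lst uNst; split; first exact: parabolic_neqT uNst.
exists 1, [set s; t]%SET; rewrite conjugate1; split=> //.
  apply: irreducible2 => [|[_ /eqP]]; last exact/negP.
  by apply: contraTneq st => ->; rewrite edge_irr.
by apply: fcG => _ _ /set2P[]-> /set2P[]-> //; rewrite edge_sym.
Qed.

Hypothesis connG : forall s t, connect (edge G) s t.
Hypothesis S3 : 2 < #|S|.

Lemma exists_neq s : exists t, s != t.
Proof.
have : ~~ ([set: S]%SET \subset [set s]%SET).
  by apply: contraL S3 => /subset_leq_card; rewrite cardsT cards1 -leqNgt => /leqW.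
by case/subsetPn => t _; rewrite inE eq_sym; exists t.
Qed.

Lemma edge_path s t : edge G s t -> parabolic_path (par [set s]%SET) (par [set t]%SET).
Proof.
move=> st; have sNt : s != t by apply: contraTneq st => ->; rewrite edge_irr.
have vs := vertex1 sNt; have vt : vertex (par [set t]%SET).
  by apply: (@vertex1 _ s); rewrite eq_sym.
case: (eqVneq (label G s t) 2) => [l2|lN2].
  apply/rt_step/parabolic_edgeP; split=> // _; apply: Or33; split=> [|p q].
    apply/seteqP; split=> [x [sx tx]|_ ->]; last by split; exact: one_parabolic.
    by apply: parabolic1_trivI sx tx; rewrite inE.
  exact: parabolic1_commute.
have : ~~ ([set: S]%SET \subset [set s; t]%SET).
  by apply: contraL S3 => /subset_leq_card; rewrite cardsT cards2 sNt -leqNgt.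
case/subsetPn => u _ uNst; have vst := vertex2 st lN2 uNst.
apply: rt_trans (rt_step _ _ _ _ (sub_edge vs vst _)) _.
  by apply: parabolic_mono; rewrite sub1set !inE eqxx.
apply/parabolic_path_sym/rt_step/sub_edge => //.
by apply: parabolic_mono; rewrite sub1set !inE eqxx orbT.
Qed.

Lemma gen_path s t : parabolic_path (par [set s]%SET) (par [set t]%SET).
Proof.
have /connectP[p] := connG s t.
elim: p s => [|u p IHp] s /= => [_ ->|/andP[su up] tE]; first exact: rt_refl.
exact: rt_trans (edge_path su) (IHp _ up tE).
Qed.

(** The elements g for which the path exists form a subgroup, because conjugation preserves paths.
    It contains each generator x: go from A_s to A_x = x A_x x^-1, then back along the conjugate by
    x of a path from A_x to A_s. *)
Lemma conjugate_path s g : parabolic_path (par [set s]%SET) (conjugate g (par [set s]%SET)).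
Proof.
have : par [set: S]%SET g by rewrite parabolicT.
move: g; apply: (@parabolic_sub _ G _ (fun g => parabolic_path _ (conjugate g _))).
  split=> [|g h gs hs|g gs]; first by rewrite conjugate1; exact: rt_refl.
  - rewrite -conjugateM; apply: rt_trans gs _.
    exact: parabolic_path_conjugate.
  - rewrite -{1}(conjugateK g (par [set s]%SET)).
    exact/parabolic_path_sym/parabolic_path_conjugate.
move=> x _; apply: rt_trans (gen_path s x) _.
have xx : par [set x]%SET (artin_gen G x) by apply: gen_parabolic; rewrite inE.
rewrite -{1}(conjugate_self (is_subgroup_parabolic G _) xx).
exact/parabolic_path_conjugate/gen_path.
Qed.

(** A vertex g A_T g^-1 contains g A_t g^-1 for any t in T, which is joined to A_t and then to a
    fixed A_s. *)
Lemma parabolic_complex_connected : complex_connected (parabolic_complex G).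
Proof.
have [s _] : exists s, s \in [set: S]%SET.
  by apply/card_gt0P; rewrite cardsT (ltn_trans _ S3).
have v1 t : vertex (par [set t]%SET) by have [u] := exists_neq t; exact: vertex1.
split; first by exists (par [set s]%SET); apply/flag_vertex.
suff to_s P : vertex P -> parabolic_path P (par [set s]%SET).
  move=> P Q /flag_vertex vP /flag_vertex vQ.
  exact: rt_trans (to_s P vP) (parabolic_path_sym (to_s Q vQ)).
move=> vP; have [_ [g [T [PE [/eqP/set0Pn[t tT] _] _]]]] := vP.
have tP : parabolic_path (conjugate g (par [set t]%SET)) P.
  apply/rt_step/sub_edge => //; first exact: vertex_conjugate.
  by rewrite PE; apply: conjugate_sub; apply: parabolic_mono; rewrite sub1set.
apply: rt_trans (parabolic_path_sym tP) _.
exact: rt_trans (parabolic_path_sym (conjugate_path t g)) (gen_path t s).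
Qed.

End ParabolicComplex.

(** * Affine actions *)

Section InfiniteCoxeter.

Import GRing.Theory.
Local Open Scope ring_scope.

Variables (S : finType) (G : labeled_graph S) (T : {set S}) (col : S -> bool).

(* If adjacent vertices always have the same colour, the two colours map to
   the reflections of the infinite dihedral group acting on the integers. *)
Lemma finite_type_monochrome :
    (forall s t, s \in T -> t \in T -> edge G s t -> col s = col t) ->
    finite_type (induced G T) ->
  forall s t, s \in T -> t \in T -> col s = col t.
Proof.
move=> edge_col finT.
pose V : finType := {s : S | s \in T}.
pose f (x : V) (b : bool) (z : int) := if col (val x) then - z else 1 - z.
have fK x b z : f x b (f x (~~ b) z) = z by rewrite /f; case: col; ring.
have fR u w : coxeter_relation (induced G T) u w -> act_word f u =1 act_word f w.
  case=> [[x [y [xy -> ->]]]|[x [-> ->]] z]; last exact: (fK x false).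
  apply: act_alt_word_sym => z; rewrite /f (edge_col (val x) (val y)) //; exact: valP.
suff no_bichrome s t : s \in T -> t \in T -> col s -> col t.
  by move=> s t sT tT; apply/idP/idP; exact: no_bichrome.
move=> sT tT cs; apply: contraT => ct.
(* This word acts by z |-> 1 - (- z) = z + 1, so its powers send 0 to infinitely many integers. *)
pose st : word V := [:: (exist _ t tT, false); (exist _ s sT, false)].
pose w n : coxeter_group (induced G T) := \pi_(_)%qT (iter n (cat st) [::]).
have wn n : act f (w n) 0 = n%:Z.
  rewrite (act_pi fK fR); elim: n => // n IHn.
  by rewrite iterS act_word_cat IHn /= /f /= cs (negPf ct); lia.
have w_inj : injective w by move=> m n /(congr1 (fun g => act f g 0)); rewrite !wn => -[].
have : finite_set (w @^-1` [set: _])%classic.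
  by apply: finite_preimage finT => m n _ _; exact: w_inj.
by rewrite preimage_setT => /infinite_nat.
Qed.

End InfiniteCoxeter.

Section AffineAction.

Import GRing.Theory.
Local Open Scope ring_scope.

Variables (S : finType) (G : labeled_graph S) (R : comUnitRingType).
Variables (a c : S -> R).

Definition affine (s : S) (b : bool) (z : R) : R :=
  if b then (a s)^-1 * (z - c s) else a s * z + c s.

Hypothesis a_unit : forall s, a s \is a GRing.unit.

Lemma affineK s b z : affine s b (affine s (~~ b) z) = z.
Proof.
by case: b => /=; rewrite ?addrK ?mulKr // mulVKr // subrK.
Qed.

Hypothesis affine_braid : forall s t, edge G s t ->
  act_word affine (alt_word s t (label G s t))
    =1 act_word affine (alt_word t s (label G s t)).

Local Notation ρ := (@act S (artin_relation G) R affine).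

Lemma affine_act (g : artin_group G) : exists γ d, γ \is a GRing.unit /\
  forall z, ρ g z = γ * z + d.
Proof.
rewrite /act; elim: (repr g) => [|[s b] w [γ [d [γu IHw]]]].
  by exists 1, 0; split=> [|z]; rewrite ?unitr1 // mul1r addr0.
case: b.
  exists ((a s)^-1 * γ), ((a s)^-1 * (d - c s)); rewrite unitrM unitrV a_unit.
  by split=> // z /=; rewrite IHw; ring.
exists (a s * γ), (a s * d + c s); rewrite unitrM a_unit.
by split=> // z /=; rewrite IHw; ring.
Qed.

(** Over a commutative ring, conjugating an affine map keeps its linear part and changes only the
    translation part. *)
Lemma affine_conjugate (g : artin_group G) s : exists γ d, γ \is a GRing.unit /\
  forall z, ρ (g * artin_gen G s * g^-1)%g z = a s * z + (γ * c s + (1 - a s) * d).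
Proof.
have fR := braid_act affine_braid.
have [γ [d [γu gE]]] := affine_act g; exists γ, d; split=> // z.
have -> : z = ρ g (γ^-1 * (z - d)) by rewrite gE mulVKr // subrK.
by rewrite !(actM affineK fR) (actVK affineK fR) (act_gen affineK fR) !gE /affine; ring.
Qed.

End AffineAction.

(** * Two colours acting by homotheties and translations *)

Section TwoColours.

Import GRing.Theory.
Local Open Scope ring_scope.
Local Open Scope classical_set_scope.

Variables (S : finType) (G : labeled_graph S) (R : comUnitRingType).
Variables (β : R) (col : S -> bool).

Local Notation par := (@standard_parabolic S G).
Local Notation vertex := (@proper_irreducible_finite_parabolic S G).

Let a s := if col s then β else 1.
Let c s : R := (~~ col s)%:R.

Hypothesis β_unit : β \is a GRing.unit.
Hypothesis β_neq1 : β != 1.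

Hypothesis affine_braid : forall s t, edge G s t ->
  act_word (affine a c) (alt_word s t (label G s t))
    =1 act_word (affine a c) (alt_word t s (label G s t)).

Hypothesis vertex_monochrome : forall P, vertex P -> exists g (T : {set S}) b,
  [/\ P = conjugate g (par T), T != finset.set0 & forall s, s \in T -> col s = b].

Let a_unit s : a s \is a GRing.unit.
Proof. by rewrite /a; case: col; rewrite ?unitr1. Qed.

(* Homotheties of ratio different from 1 and translations by units never commute. *)
Lemma bichrome_not_nested_or_commute g h (T U : {set S}) :
    T != finset.set0 -> U != finset.set0 ->
    (forall s, s \in T -> col s) -> (forall s, s \in U -> ~~ col s) ->
    let P := conjugate g (par T) in let Q := conjugate h (par U) in
  ~ [\/ P `<=` Q, Q `<=` P | forall p q, P p -> Q q -> (p * q = q * p)%g].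
Proof.
move=> /set0Pn[s sT] /set0Pn[t tU] cT cU P Q PQ.
have aff_eq x y v : col x = col y -> affine a c x false v = affine a c y false v.
  by rewrite /affine /a /c => ->.
have fT x v : x \in T -> affine a c x false v = affine a c s false v.
  by move=> /cT xT; apply: aff_eq; rewrite xT cT.
have fU x v : x \in U -> affine a c x false v = affine a c t false v.
  by move=> /cU/negPf xU; apply: aff_eq; rewrite xU (negPf (cU _ tU)).
have := conjugate_act_commute (affineK c a_unit) affine_braid fT fU sT tU PQ 0.
have [γ [d [_ pE]]] := affine_conjugate a_unit affine_braid g s.
have [γ' [d' [γ'u qE]]] := affine_conjugate a_unit affine_braid h t.
rewrite !pE !qE /a /c cT // (negPf (cU _ tU)) /= => comm.
(* At 0, the maps z |-> β z + e and z |-> z + γ' commute only if β γ' = γ'. *)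
have {}comm : γ' * (β - 1) = 0.
  by move/eqP: comm; rewrite -subr_eq0 => /eqP <-; ring.
by case/eqP: β_neq1; apply/subr0_eq/(mulrI γ'u); rewrite comm mulr0.
Qed.

(** Every vertex has a colour and adjacent vertices never have opposite ones, so the colour of A_s
    would spread to A_t. *)
Lemma bichrome_not_connected s t : col s -> ~~ col t ->
    vertex (par [set s]%SET) -> vertex (par [set t]%SET) ->
  ~ complex_connected (parabolic_complex G).
Proof.
move=> cs ct vs vt.
pose I (P : set (artin_group G)) := exists g (T : {set S}),
  [/\ P = conjugate g (par T), T != finset.set0 & forall s, s \in T -> col s].
move=> conn; have [||g [T [PT T0 cT]]] := connected_invariant (I := I) _ conn vs vt.
- move=> P Q _ vQ /adjacent_nested_or_commute PQ [g [T [PE T0 cT]]].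
  have [h [U [[] [QE U0 cU]]]] := vertex_monochrome vQ; first by exists h, U.
  case: (@bichrome_not_nested_or_commute g h T U) => //; last by rewrite -PE -QE.
  by move=> u /cU ->.
- exists 1%g, [set s]%SET; rewrite conjugate1; split=> //; last by move=> _ /set1P->.
  by apply/set0Pn; exists s; rewrite inE.
(* The same subgroup A_t would be presented with both colours, which is absurd as it is contained in
   itself. *)
case: (@bichrome_not_nested_or_commute g 1%g T [set t]%SET) => //.
- by apply/set0Pn; exists t; rewrite inE.
- by move=> _ /set1P->.
- by rewrite -PT conjugate1; apply: Or31.
Qed.

End TwoColours.

(** * Graphs with two vertices and one edge *)

Section Dihedral.

Import GRing.Theory.
Local Open Scope ring_scope.
Local Open Scope classical_set_scope.

Variables (S : finType) (G : labeled_graph S) (s t : S).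
Hypothesis st : edge G s t.
Hypothesis S_st : forall x : S, x = s \/ x = t.

Local Notation par := (@standard_parabolic S G).
Local Notation vertex := (@proper_irreducible_finite_parabolic S G).

Let sNt : s != t.
Proof. by apply: contraTneq st => ->; rewrite edge_irr. Qed.

(** If T had two elements it would be all of S, and P would not be proper. *)
Lemma dihedral_vertex P : vertex P -> exists g x, P = conjugate g (par [set x]%SET).
Proof.
move=> [PT [g [T [PE [/eqP/set0Pn[x xT] _] _]]]]; exists g, x.
suff -> : [set x]%SET = T by [].
apply/setP => y; rewrite inE; apply/eqP/idP => [->//|yT].
apply: contrapT => yx; apply: PT; rewrite PE; apply/conjugate_eqT.
rewrite (_ : T = [set: S]%SET) ?parabolicT //; apply/setP => z; rewrite inE.
have [->|->] // : z = x \/ z = y.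
by move: (S_st x) (S_st y) (S_st z) yx; intuition congruence.
Qed.

Section Even.

Variables (R : comUnitRingType) (β : R) (k : nat).
Hypothesis β_unit : β \is a GRing.unit.
Hypothesis β_neq1 : β != 1.
Hypothesis βk : β ^+ k = 1.
Hypothesis label_st : label G s t = k.*2.

Let a x := if x == s then β else 1.
Let c x : R := (x != s)%:R.

(** With σ n = 1 + β + ... + β^(n-1), the words of length 2n act by z |-> β^n z + β σ n and z |->
    β^n z + σ n. *)
Lemma even_braid x y : edge G x y ->
  act_word (affine a c) (alt_word x y (label G x y))
    =1 act_word (affine a c) (alt_word y x (label G x y)).
Proof.
have tNs : (t == s) = false by rewrite eq_sym (negPf sNt).
pose σ n := iter n (fun z => β * z + 1) 0.
have σS n : σ n.+1 = σ n + β ^+ n.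
  elim: n => [|n IHn]; first by rewrite /σ /= mulr0.
  by rewrite /σ iterS -/(σ n.+1) {1}IHn /σ iterS -/(σ n) exprS; ring.
have stE n z : act_word (affine a c) (alt_word s t n.*2) z = β ^+ n * z + β * σ n.
  elim: n => [|n IHn]; first by rewrite /= mul1r mulr0 addr0.
  rewrite doubleS !act_alt_wordS IHn /affine /a /c eqxx tNs /σ iterS -/(σ n) exprS.
  by rewrite /=; ring.
have tsE n z : act_word (affine a c) (alt_word t s n.*2) z = β ^+ n * z + σ n.
  elim: n => [|n IHn]; first by rewrite /= mul1r addr0.
  rewrite doubleS !act_alt_wordS IHn /affine /a /c eqxx tNs /σ iterS -/(σ n) exprS.
  by rewrite /=; ring.
(* Both β σ k + 1 and σ k + β^k equal σ (k + 1), and β^k = 1. *)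
have σk : β * σ k = σ k.
  by apply: (addIr 1); rewrite -[LHS]/(σ k.+1) σS βk.
have stts z : act_word (affine a c) (alt_word s t (label G s t)) z
    = act_word (affine a c) (alt_word t s (label G s t)) z.
  by rewrite label_st stE tsE σk.
case: (S_st x) (S_st y) => -> [] -> ts z; rewrite ?edge_irr // in ts *.
by rewrite -(label_sym st) stts.
Qed.

Lemma dihedral_even_not_connected :
    vertex (par [set s]%SET) -> vertex (par [set t]%SET) ->
  ~ complex_connected (parabolic_complex G).
Proof.
apply: (bichrome_not_connected (col := pred1 s) β_unit β_neq1 even_braid) => /=.
- move=> P /dihedral_vertex[g [x ->]]; exists g, [set x]%SET, (x == s).
  split=> //; last by move=> _ /set1P->.
  by apply/set0Pn; exists x; rewrite inE.
- exact: eqxx.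
- by rewrite eq_sym sNt.
Qed.

End Even.

Section Odd.

Variables (R : comUnitRingType) (k : nat).
Hypothesis kR : k.*2.+1%:R = 0 :> R.
Hypothesis label_st : label G s t = k.*2.+1.

Let a (x : S) : R := -1.
Let c x : R := (x != s)%:R.

(** The words act by z |-> - z - k and z |-> 1 - z + k, which differ by 2k + 1 = 0. *)
Lemma odd_braid x y : edge G x y ->
  act_word (affine a c) (alt_word x y (label G x y))
    =1 act_word (affine a c) (alt_word y x (label G x y)).
Proof.
have tNs : (t == s) = false by rewrite eq_sym (negPf sNt).
have stE n z : act_word (affine a c) (alt_word s t n.*2.+1) z = - z - n%:R.
  elim: n => [|n IHn]; first by rewrite act_alt_wordS /affine /a /c eqxx /=; ring.
  rewrite doubleS act_alt_wordS act_alt_wordS IHn /affine /a /c eqxx tNs /= mulrSr.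
  by ring.
have tsE n z : act_word (affine a c) (alt_word t s n.*2.+1) z = 1 - z + n%:R.
  elim: n => [|n IHn]; first by rewrite act_alt_wordS /affine /a /c tNs /=; ring.
  rewrite doubleS act_alt_wordS act_alt_wordS IHn /affine /a /c eqxx tNs /= mulrSr.
  by ring.
have stts z : act_word (affine a c) (alt_word s t (label G s t)) z
    = act_word (affine a c) (alt_word t s (label G s t)) z.
  rewrite label_st stE tsE; apply/eqP; rewrite -subr_eq0 -oppr_eq0 -kR.
  by apply/eqP; rewrite -addnn -[RHS]natr1 natrD; ring.
case: (S_st x) (S_st y) => -> [] -> ts z; rewrite ?edge_irr // in ts *.
by rewrite -(label_sym st) stts.
Qed.

Local Notation ρ := (@act S (artin_relation G) R (affine a c)).

(* In the dihedral group of order 2 (2k + 1), acting on R by reflections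
   z |-> e - z, commuting reflections are equal; hence fixing 0 is a property
   shared by all the vertices of a connected component. *)
Lemma dihedral_odd_not_connected :
    vertex (par [set s]%SET) -> vertex (par [set t]%SET) ->
  ~ complex_connected (parabolic_complex G).
Proof.
move=> vs vt conn; have a_unit x : a x \is a GRing.unit by rewrite unitrN1.
have fK := affineK c a_unit; have fR := braid_act odd_braid.
(* As 2k + 1 = 0, doubling is injective: x = (2k + 1) x - k (2 x). *)
have no2 (x : R) : x *+ 2 = 0 -> x = 0.
  move=> x2; have : x * k.*2.+1%:R = 0 by rewrite kR mulr0.
  by rewrite mulr_natr mulrS -mul2n mulrnA x2 mul0rn addr0.
pose I (P : set (artin_group G)) := forall g, P g -> ρ g 0 = 0.
(* It is enough to test the conjugated generator: if it fixes 0, then x fixes h^-1 0, and so does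
   all of A_x. *)
have I_conj h x : ρ (h * artin_gen G x * h^-1)%g 0 = 0 -> I (conjugate h (par [set x]%SET)).
  rewrite !(actM fK fR) (act_gen fK fR) => /(congr1 (ρ h^-1%g)).
  rewrite !(actVK fK fR) => xfix _ [g xg <-]; rewrite !(actM fK fR).
  rewrite (parabolic_act_fix fK odd_braid _ xg) ?(actKV fK fR) //.
  by move=> _ /set1P->.
have : I (par [set t]%SET).
  apply: (connected_invariant (I := I) _ conn vs vt) => [P Q|].
    move=> /dihedral_vertex[g [x ->]] /dihedral_vertex[h [y ->]].
    move=> /adjacent_nested_or_commute PQ IP; apply: I_conj.
    have fX z w v : w \in [set z]%SET -> affine a c w false v = affine a c z false v.
      by move=> /set1P->.
    have := conjugate_act_commute fK odd_braid (fX x) (fX y) (set11 x) (set11 y) PQ 0.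
    have : ρ (g * artin_gen G x * g^-1)%g 0 = 0.
      by apply: IP; exists (artin_gen G x) => //; apply: gen_parabolic; exact: set11.
    have [γ [d [_ pE]]] := affine_conjugate a_unit odd_braid g x.
    have [γ' [d' [_ qE]]] := affine_conjugate a_unit odd_braid h y.
    (* The reflections are z |-> e - z and z |-> e' - z. The invariant gives e = 0, and commutation
       at 0 becomes - e' = e'. *)
    rewrite !pE !qE /a; move: (γ * c x + _) (γ' * c y + _) => e e'.
    rewrite mulr0 add0r => -> /eqP; rewrite -subr_eq0 => /eqP e2.
    by apply: no2; rewrite -oppr0 -[in RHS]e2; ring.
  apply: (parabolic_act_fix fK odd_braid) => _ /set1P->.
  by rewrite /affine /c eqxx mulr0 addr0.
move=> /(_ (artin_gen G t)); rewrite (act_gen fK fR) /affine /c eq_sym sNt mulr0 add0r.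
by move=> /(_ (gen_parabolic (set11 t)))/eqP; rewrite oner_eq0.
Qed.

End Odd.

End Dihedral.

(** * Obstructions to connectedness *)

Section AffineObstructions.

Import GRing.Theory.
Local Open Scope classical_set_scope.

(** The colour records membership in the component of s, and β = -1 over the integers. Generators
    joined by an edge act alike, which gives the braid relations; a finite type T cannot meet both
    colours. *)
Lemma parabolic_complex_connect (S : finType) (G : labeled_graph S) :
    fc_type G -> complex_connected (parabolic_complex G) ->
  forall s t : S, connect (edge G) s t.
Proof.
move=> fcG conn s t; apply: contraT => st.
have sNt : s != t by apply: contraNneq st => ->; exact: connect0.
have unitN1 : (-1 : int)%R \is a GRing.unit by [].
have edge_col x y : edge G x y -> connect (edge G) s x = connect (edge G) s y.
  move=> xy; apply/idP/idP => /connect_trans; apply; apply: connect1 => //.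
  by rewrite edge_sym.
case: (bichrome_not_connected (col := connect (edge G) s) unitN1 _ _ _ (connect0 _ s) st
    (vertex1 fcG sNt) _ conn) => //.
- move=> x y /edge_col xy; apply: act_alt_word_sym => z.
  by rewrite /affine xy.
- move=> P [_ [g [T [PE [/eqP T0 _] finT]]]]; exists g, T.
  have /set0Pn[x xT] := T0.
  exists (connect (edge G) s x); split=> // y yT.
  by apply: (finite_type_monochrome _ finT) => // z w _ _; exact: edge_col.
- by apply: (vertex1 fcG (t := s)); rewrite eq_sym.
Qed.

Lemma dihedral_not_connected (S : finType) (G : labeled_graph S) (s t : S) :
    fc_type G -> edge G s t -> 2 < label G s t -> (forall x : S, x = s \/ x = t) ->
  ~ complex_connected (parabolic_complex G).
Proof.
move=> fcG st l3 S_st.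
have sNt : s != t by apply: contraTneq st => ->; rewrite edge_irr.
have vs := vertex1 fcG sNt.
have vt : proper_irreducible_finite_parabolic (@standard_parabolic S G [set t]%SET).
  by apply: (vertex1 fcG (t := s)); rewrite eq_sym.
set m := label G s t in l3; have := odd_double_half m; set k := m./2.
case: (odd m) => mk.
  have m0 : (k.*2.+1%:R = 0 :> 'Z_m)%R by rewrite (_ : k.*2.+1 = m) // pchar_Zp // (ltnW l3).
  exact: (dihedral_odd_not_connected st S_st m0 (esym mk) vs vt).
have k1 : 1 < k by rewrite -ltn_double -[k.*2]add0n mk.
(* Modulo 2^k - 1 the ratio β = 2 satisfies β^k = 1. A label above 2 gives k > 1, so the modulus is
   at least 3 and ['Z_n] is the ring of integers modulo n. *)
pose n := (2 ^ k).-1; have nE : n.+1 = 2 ^ k by rewrite prednK ?expn_gt0.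
have n1 : 1 < n.
  by rewrite -ltnS nE (leq_trans (_ : 2 < 2 ^ 2)) // leq_exp2l.
have two_k : (2%:R ^+ k = 1 :> 'Z_n)%R.
  by rewrite -natrX -nE -natr1 pchar_Zp // add0r.
have two_unit : (2%:R : 'Z_n)%R \is a GRing.unit.
  by apply/unitrP; exists (2%:R ^+ k.-1)%R; rewrite -exprS -exprSr prednK ?(ltnW k1).
have two_neq1 : (2%:R != 1 :> 'Z_n)%R by rewrite -subr_eq0 -[2%:R%R]natr1 addrK oner_neq0.
exact: (dihedral_even_not_connected st S_st two_unit two_neq1 two_k (esym mk) vs vt).
Qed.

End AffineObstructions.

(** * The equivalence *)

Theorem lemma5p2 (S : finType) (G : labeled_graph S)
    (irrG : irreducible G [set: S]) (fcG : fc_type G) :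
  complex_connected (parabolic_complex G) <->
  (forall s t : S, connect (edge G) s t) /\ 3 <= #|S|.
Proof.
split=> [conn|[connG S3]]; last exact: parabolic_complex_connected.
have connG := parabolic_complex_connect fcG conn; split=> //.
have [[P /flag_vertex [PT [g [T [PE [/eqP/set0Pn[s sT] _] _]]]]] _] := conn.
rewrite leqNgt; apply/negP => S2.
(* With a single vertex, the nonempty T is all of S, so the vertex P of the complex would not be
   proper. *)
have [/existsP[t tNs]|/existsPn S1] := boolP [exists t, t != s]; last first.
  apply: PT; rewrite PE; apply/conjugate_eqT.
  rewrite (_ : T = [set: S]) ?parabolicT //; apply/setP => x.
  by have := S1 x; rewrite negbK inE => /eqP->.
have S_st x : x = s \/ x = t.
  have [|xNs] := eqVneq x s; first by left.
  right; apply/eqP; apply: contraLR S2 => xNt; rewrite -leqNgt.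
  have /card_uniqP c3 : uniq [:: x; s; t].
    by rewrite /= !inE negb_or xNs xNt eq_sym tNs.
  by rewrite (leq_trans _ (max_card (mem [:: x; s; t]))) ?c3.
have st : edge G s t.
  have /connectP[[|x p] /=] := connG s t; first by move=> _ ts; rewrite ts eqxx in tNs.
  by case: (S_st x) => -> /andP[]; rewrite ?edge_irr.
apply: (dihedral_not_connected fcG st _ S_st conn).
(* A label 2 would split S into {s} and {t}, against irreducibility. *)
rewrite ltn_neqAle label_ge2 // andbT; apply/eqP => l2.
case: irrG => _; apply; exists [set s], [set t]; split.
- by apply/eqP/set0Pn; exists s; rewrite inE.
- by apply/eqP/set0Pn; exists t; rewrite inE.
- by apply/setP => x; rewrite !inE; case: (S_st x) => ->; rewrite eqxx ?orbT.
- apply/setP => x; rewrite !inE; apply/andP => -[/eqP-> /eqP st'].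
  by rewrite st' eqxx in tNs.
- by move=> _ _ /set1P-> /set1P->.
Qed.
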